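(* If $T$ is a tree of order $n\geq 3$, then $tpc(T)=\Delta(T)+1$, where $\Delta(T)$ is the maximum degree of $T$.
   Context: All graphs are simple, finite and undirected. A graph is total-colored if every vertex and every edge receives a color. A path $v_1v_2\ldots v_s$ in a total-colored graph is a total proper path if (i) any two adjacent edges on the path have different colors, (ii) any two adjacent internal vertices of the path (vertices among $v_2,\ldots,v_{s-1}$) have different colors, and (iii) every internal vertex of the path has a color different from the colors of its two incident edges on the path. A total-colored graph is total proper connected if every two vertices are joined by a total proper path. For a connected graph $G$, the total proper connection number $tpc(G)$ is the smallest number of colors in a total-coloring making $G$ total proper connected. *)

(* Defs.v *)
From mathcomp Require Import all_boot.
From mathcomp Require Import boolp.

Set Implicit Arguments.
Unset Strict Implicit.
Unset Printing Implicit Defensive.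

Record sgraph := SGraph {
  vertex :> finType;
  adj : rel vertex;
  adj_sym : symmetric adj;
  adj_irrefl : irreflexive adj }.

Definition degree (G : sgraph) (x : G) : nat := #|[set y | adj x y]|.

Definition max_degree (G : sgraph) : nat := \max_(x : G) degree x.

Definition connected_graph (G : sgraph) : Prop :=
  forall x y : G, connect (@adj G) x y.

(* [:: x; y] is a ucycle for every edge xy, hence the bound on the size. *)
Definition acyclic_graph (G : sgraph) : Prop :=
  forall p : seq G, ucycle (@adj G) p -> size p < 3.

Definition is_tree (G : sgraph) : Prop := connected_graph G /\ acyclic_graph G.

(* The edge xy is the set [set x; y]; the values of ecol at the other sets are
   irrelevant. *)
Record total_coloring (G : sgraph) (k : nat) := TotalColoring {
  vcol : G -> 'I_k;
  ecol : {set G} -> 'I_k }.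

(* The path x :: p has vertices v 0, ..., v (size p); its internal vertices are
   v 1, ..., v (size p - 1). *)
Definition total_proper_path (G : sgraph) (k : nat) (c : total_coloring G k)
    (x : G) (p : seq G) : Prop :=
  let v := nth x (x :: p) in
  let ec i := ecol c [set v i; v i.+1] in
  [/\ path (@adj G) x p /\ uniq (x :: p),
      forall i, i.+1 < size p -> ec i <> ec i.+1,
      forall i, 0 < i -> i.+1 < size p -> vcol c (v i) <> vcol c (v i.+1) &
      forall i, 0 < i < size p ->
        vcol c (v i) <> ec i.-1 /\ vcol c (v i) <> ec i].

Definition total_proper_connected (G : sgraph) (k : nat)
    (c : total_coloring G k) : Prop :=
  forall x y : G, x != y ->
    exists2 p : seq G, total_proper_path c x p & last x p = y.

Definition tpc_colorable (G : sgraph) (k : nat) : Prop :=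
  exists c : total_coloring G k, total_proper_connected c.

(* Giving all vertices and edges distinct colors works in a connected graph. *)
Lemma tpc_colorable_ex (G : sgraph) (cG : connected_graph G) :
  exists k, `[< tpc_colorable G k >].
Proof.
exists #|{: G + {set G}}|; apply/asboolP.
exists (TotalColoring (fun x => enum_rank (inl x : G + {set G}))
                      (fun A => enum_rank (inr A : G + {set G}))).
move=> x y _; have /connectP[p0 p0P ->] := cG x y.
have [p pP pU _] := shortenP p0P; exists p => //.
have neq i j : i < j <= size p -> nth x (x :: p) i == nth x (x :: p) j = false.
  by case/andP=> ij jp; rewrite nth_uniq ?ltn_eqF //= ltnS // ltnW // (leq_trans ij).
split=> //.
- move=> i ip /enum_rank_inj[] /setP /(_ (nth x (x :: p) i)).
  rewrite !in_set2 eqxx (neq i i.+1) ?leqnn 1?ltnW // (neq i i.+2) //.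
  by rewrite leqnSn.
- move=> i _ ip /enum_rank_inj[] /eqP.
  by rewrite (neq i i.+1) // leqnn ltnW.
- by move=> i _; split=> /enum_rank_inj.
Qed.

Definition tpc (G : sgraph) (cG : connected_graph G) : nat :=
  ex_minn (tpc_colorable_ex cG).

(* Main.v *)
Require Import Defs.
From mathcomp Require Import all_boot.
From mathcomp Require Import boolp.

Set Implicit Arguments.
Unset Strict Implicit.
Unset Printing Implicit Defensive.

(** Lower bound: in a tree the only path between two neighbours y, z of x is
    y x z, so a total proper connected coloring gives distinct colors to x and
    to all the edges at x.  Upper bound: a tree is obtained from a single vertex
    by adding leaves one at a time, and Delta + 1 >= 3 colors let one extend
    greedily a proper total coloring first to the new edge xy, which must avoid
    x and the at most Delta - 1 other edges at x, and then to the new leaf y,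
    which must avoid only x and xy. *)

(** If [p] avoids [x], the edges [xy] and [xz] close it into a cycle. If it meets [x], its parts
    before and after [x] each close through an edge at [x], and acyclicity reduces each part to a
    single edge. *)
Lemma acyclic_path_between_neighbors (G : sgraph) (x y z : G) (p : seq G) :
  acyclic_graph G -> adj x y -> adj x z -> y != z ->
  path (@adj G) y p -> uniq (y :: p) -> last y p = z -> p = [:: x; z].
Proof.
move=> acG xy xz yz pP pU pz.
have nxz : x != z by apply: contraTneq xz => ->; rewrite adj_irrefl.
have nxy : x != y by apply: contraTneq xy => ->; rewrite adj_irrefl.
have [xp|xNp] := boolP (x \in p); last first.
  have : ucycle (@adj G) (x :: y :: p).
    rewrite /ucycle /= rcons_path xy pP pz adj_sym xz /=.
    by rewrite inE negb_or nxy xNp /=; case/andP: pU => ->.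
  by move/acG; case: p {pP pU xNp} pz => //= /eqP; rewrite (negPf yz).
case/splitPr: xp pP pU pz => p1 p2; rewrite cat_path last_cat /=.
move=> /and3P[p1P p1x p2P] pU p2z.
have c1 : ucycle (@adj G) (rcons (y :: p1) x).
  rewrite /ucycle /= !rcons_path last_rcons p1P p1x xy /=.
  have : uniq (rcons (y :: p1) x ++ p2) by rewrite cat_rcons.
  by rewrite cat_uniq => /andP[].
have /nilP p1nil : nilp p1.
  by have := acG _ c1; rewrite size_rcons /= !ltnS leqn0.
rewrite p1nil /= in pU *.
have c2 : ucycle (@adj G) (x :: p2).
  rewrite /ucycle /= rcons_path p2P p2z adj_sym xz /=.
  by case/and3P: pU => _ -> ->.
have := acG _ c2; case: p2 p2z {p2P pU c2} => [/eqP|a [|b p2]] //=.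
  by rewrite (negPf nxz).
by move=> ->.
Qed.

Lemma two_neighbors_max_degree (G : sgraph) (x y z : G) :
  adj x y -> adj x z -> y != z -> 2 <= max_degree G.
Proof.
move=> xy xz yz; apply: leq_trans (leq_bigmax x).
rewrite -[2]/(true.+1) -yz -cards2; apply: subset_leq_card.
by apply/subsetP => u; rewrite !inE => /orP[] /eqP->.
Qed.

(** If all degrees were at most 1, a repetition-free path could not have two edges. Distinct
    vertices would then be adjacent, which three vertices contradict. *)
Lemma connected_max_degree_ge2 (G : sgraph) :
  connected_graph G -> 3 <= #|G| -> 2 <= max_degree G.
Proof.
move=> cG; rewrite cardT => n3; rewrite leqNgt; apply/negP => lt2.
have noV (u v w : G) : adj u v -> adj u w -> v = w.
  move=> uv uw; apply/eqP; apply: contraLR lt2 => vw.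
  by rewrite -leqNgt (two_neighbors_max_degree uv uw).
have adjT (x y : G) : x != y -> adj x y.
  have /connectP[p0 p0P ->] := cG x y.
  have [p pP pU _] := shortenP p0P.
  case: p pP pU => [|a [|b p]] /=; rewrite ?eqxx ?andbT //.
  case/and3P=> xa ab _ /andP[]; rewrite adj_sym in xa.
  by rewrite (noV _ _ _ xa ab) !inE eqxx orbT.
move: n3 (enum_uniq G); case: (enum G) => [|x [|y [|z s]]] //= _.
rewrite !inE !negb_or -!andbA => /and5P[xy xz _ yz _].
by move: yz; rewrite (noV _ _ _ (adjT _ _ xy) (adjT _ _ xz)) eqxx.
Qed.

Lemma tpc_colorable_tree_degree (G : sgraph) (k : nat) (x : G) :
  acyclic_graph G -> 2 <= degree x -> tpc_colorable G k -> degree x < k.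
Proof.
move=> acG deg2 [c cP]; set N := [set y | adj x y].
pose f y := ecol c [set y; x].
have fP y z : y \in N -> z \in N -> y != z -> f y <> f z /\ vcol c x <> f y.
  rewrite !inE => xy xz yz; have [p [[pP pU] Hee _ Hve] pz] := cP y z yz.
  have pE := acyclic_path_between_neighbors acG xy xz yz pP pU pz.
  rewrite {}pE /= in Hee Hve.
  split; last by have [] := Hve 1 isT.
  by have := Hee 0 isT; rewrite /= [[set x; z]]setUC.
have f_inj : {in N &, injective f}.
  move=> y z yN zN fyz; apply/eqP/negPn/negP => yz.
  by have [] := fP y z yN zN yz.
have vNf : vcol c x \notin f @: N.
  apply/imsetP => -[y yN vf].
  (* The color of [x] is compared with that of an edge [xy] only on a path with [x] as an internal
     vertex, hence the second neighbor [z]. *)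
  have : 0 < #|N :\ y| by move: deg2; rewrite /degree -/N (cardsD1 y) yN.
  case/card_gt0P=> z; rewrite in_setD1 eq_sym => /andP[yz zN].
  by have [_ []] := fP y z yN zN yz.
have := max_card [in vcol c x |: f @: N].
by rewrite card_ord cardsU1 vNf card_in_imset // add1n.
Qed.

(** A total coloring in the classical sense of the subgraph induced by [S]: a local condition,
    suited to induction on [S]. *)
Definition proper_on (G : sgraph) (k : nat) (c : total_coloring G k)
    (S : {set G}) : Prop :=
  [/\ {in S &, forall u v, adj u v -> vcol c u != vcol c v},
      {in S &, forall u v, adj u v -> vcol c u != ecol c [set u; v]} &
      {in S & &, forall u v w, adj u v -> adj u w -> v != w ->
                   ecol c [set u; v] != ecol c [set u; w]}].

Lemma ord_avoid (k : nat) (A : {set 'I_k}) : #|A| < k -> exists a, a \notin A.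
Proof.
move=> ltA; have : 0 < #|~: A| by rewrite cardsCs setCK card_ord subn_gt0.
by case/card_gt0P=> a; rewrite inE; exists a.
Qed.

Lemma proper_on_add_leaf (G : sgraph) (k : nat) (c : total_coloring G k)
    (S : {set G}) (x y : G) :
  2 < k -> degree x < k -> x \in S -> y \notin S -> adj x y ->
  (forall u, u \in S -> adj u y -> u = x) ->
  proper_on c S -> exists c' : total_coloring G k, proper_on c' (y |: S).
Proof.
move=> k3 degk xS yS xy xuniq [Hvv Hve Hee].
have [e] : exists e, e \notin vcol c x |:
    [set ecol c [set x; z] | z in [set z in S | adj x z]].
  apply: ord_avoid; apply: leq_ltn_trans degk; rewrite cardsU1.
  apply: leq_trans (_ : 1 + #|[set z in S | adj x z]| <= _).
    by rewrite leq_add ?leq_b1 ?leq_imset_card.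
  (* The neighbor [y] of [x] lies outside [S], so the inclusion is strict; this leaves room for the
     color of [x] among the forbidden ones. *)
  rewrite add1n; apply: proper_card; apply/properP; split.
    by apply/subsetP => z; rewrite !inE => /andP[].
  by exists y; rewrite !inE ?xy // (negPf yS).
rewrite in_setU1 negb_or => /andP[ex /imsetP eS].
have {}eS w : w \in S -> adj x w -> e != ecol c [set x; w].
  by move=> wS xw; apply/eqP => ew; apply: eS; exists w; rewrite // inE wS.
have [b] : exists b, b \notin [set vcol c x; e].
  by apply: ord_avoid; apply: leq_ltn_trans k3; rewrite cards2; case: (_ != _).
rewrite !inE negb_or => /andP[bx be].
pose vc v := if v == y then b else vcol c v.
pose ec A := if A == [set x; y] then e else ecol c A.
have vcS v : v \in S -> vc v = vcol c v.
  by rewrite /vc; case: eqP => // ->; rewrite (negPf yS).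
(* The recolored edge contains [y], so no edge inside [S] is affected. *)
have ecS u v : u \in S -> v \in S -> ec [set u; v] = ecol c [set u; v].
  move=> uS vS; rewrite /ec; case: eqP => // /setP/(_ y).
  rewrite !inE eqxx orbT => /orP[] /eqP yE; by rewrite yE ?uS ?vS in yS.
have vcy : vc y = b by rewrite /vc eqxx.
have ecxy : ec [set x; y] = e by rewrite /ec eqxx.
have ecyx : ec [set y; x] = e by rewrite setUC.
have xuniq' u : u \in S -> adj y u -> u = x by rewrite adj_sym; apply: xuniq.
exists (TotalColoring vc ec); split=> /=.
- move=> u v; rewrite !in_setU1 => /predU1P[->|uS] /predU1P[->|vS] uv.
  + by rewrite adj_irrefl in uv.
  + by rewrite (xuniq' v) // vcy vcS.
  + by rewrite (xuniq u) // vcy vcS // eq_sym.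
  + by rewrite !vcS // Hvv.
- move=> u v; rewrite !in_setU1 => /predU1P[->|uS] /predU1P[->|vS] uv.
  + by rewrite adj_irrefl in uv.
  + by rewrite (xuniq' v) // vcy ecyx.
  + by rewrite (xuniq u) // vcS // ecxy eq_sym.
  + by rewrite vcS // ecS // Hve.
- move=> u v w; rewrite !in_setU1.
  move=> /predU1P[->|uS] /predU1P[->|vS] /predU1P[->|wS] uv uw;
    rewrite ?adj_irrefl // ?eqxx // in uv uw * => vw.
  (* Four cases survive: [y] as the common end, impossible with a single neighbor in [S]; [y] as one
     of the other ends, where [u] is [x] and [e] avoids the second edge; and all vertices in [S]. *)
  + by move: vw; rewrite (xuniq' v) // (xuniq' w) // eqxx.
  + by move: uw; rewrite (xuniq u) // ecxy ecS //; apply: eS.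
  + by move: uv; rewrite (xuniq u) // ecxy ecS // eq_sym; apply: eS.
  + by rewrite !ecS // Hee.
Qed.

Definition adj_in (G : sgraph) (S : {set G}) : rel G :=
  [rel u v | [&& adj u v, u \in S & v \in S]].

Lemma adj_in_sym (G : sgraph) (S : {set G}) : symmetric (adj_in S).
Proof. by move=> u v; rewrite /adj_in /= adj_sym [(u \in S) && _]andbC. Qed.

(** Otherwise a path from [u] to [v] inside [S] would close through [y], which lies outside [S],
    into a cycle. This makes each added vertex a leaf. *)
Lemma acyclic_neighbor_unique (G : sgraph) (S : {set G}) (y u v : G) :
  acyclic_graph G -> y \notin S -> u \in S ->
  connect (adj_in S) u v -> adj u y -> adj v y -> u = v.
Proof.
move=> acG yS uS /connectP[p0 p0P ->] uy.
have [p pP pU _ vy] := shortenP p0P; apply/eqP.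
have pS : {subset p <= S}.
  elim: p u pP {uS uy pU vy p0P} => //= a p IHp u /andP[/and3P[_ _ aS] pP] z.
  by rewrite inE => /predU1P[->//|]; apply: IHp pP z.
have : ucycle (@adj G) (y :: u :: p).
  rewrite /ucycle /= rcons_path adj_sym uy vy andbT /=.
  rewrite (sub_path _ pP) /=; last by move=> a b /and3P[].
  move: pU => /= ->; rewrite andbT inE negb_or; apply/andP; split.
    by apply: contraNneq yS => ->.
  by apply: contra yS; apply: pS.
by move/acG; case: p {pP pU vy pS} => //=; rewrite eqxx.
Qed.

(** Without such an edge [S] is closed under adjacency, so it contains everything reachable from
    [r]. *)
Lemma connected_boundary_edge (G : sgraph) (S : {set G}) (r : G) :
  connected_graph G -> r \in S -> S != setT ->
  exists x y, [/\ x \in S, y \notin S & adj x y].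
Proof.
move=> cG rS SnT; apply: contrapT => noE; case/negP: SnT.
have clS : closed (@adj G) [in S].
  apply: intro_closed; first exact/sym_connect_sym/adj_sym.
  move=> x y xy xS; apply: contrapT => /negP yS; apply: noE.
  by exists x, y.
apply/eqP/setP => z; rewrite inE -[z \in S]/(z \in [in S]).
by rewrite -(closed_connect clS (cG r z)).
Qed.

Lemma tree_proper_coloring (G : sgraph) (k : nat) :
  is_tree G -> 2 < k -> (forall x : G, degree x < k) ->
  exists c : total_coloring G k, proper_on c setT.
Proof.
move=> [cG acG] k3 degk.
pose k0 : 'I_k := Ordinal (ltnW (ltnW k3)).
pose c0 := TotalColoring (fun _ : G => k0) (fun=> k0).
have [r _|G0] := pickP (@predT G); last first.
  by exists c0; split=> u; have := G0 u.
(* Connectedness inside [S] is carried along because it forces the next vertex to have only one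
   neighbor in [S]. *)
have grow n : n < #|G| -> exists S : {set G}, [/\ #|S| = n.+1, r \in S,
    {in S, forall u, connect (adj_in S) r u} &
    exists c : total_coloring G k, proper_on c S].
  elim: n => [|n IHn] ltn.
    exists [set r]; split; rewrite ?cards1 ?set11 //.
      by move=> u /set1P->; apply: connect0.
    by exists c0; split=> u v; [| |move=> w]; move=> /set1P-> /set1P->;
       rewrite ?adj_irrefl // => _; rewrite adj_irrefl.
  have [S [cardS rS conS [c cP]]] := IHn (ltnW ltn).
  have SnT : S != setT.
    by apply: contraTneq ltn => ST; rewrite -cardS ST cardsT ltnn.
  have [x [y [xS yS xy]]] := connected_boundary_edge cG rS SnT.
  exists (y |: S); split.
  - by rewrite cardsU1 yS cardS.
  - by rewrite in_setU1 rS orbT.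
  - have mono u : u \in S -> connect (adj_in (y |: S)) r u.
      move=> uS; apply: (connect_sub _ (conS u uS)) => a b /and3P[ab aS bS].
      by apply: connect1; rewrite /adj_in /= ab !in_setU1 aS bS !orbT.
    move=> u; rewrite in_setU1 => /predU1P[->|]; last exact: mono.
    apply: (connect_trans (mono x xS)); apply: connect1.
    by rewrite /adj_in /= xy !in_setU1 xS eqxx orbT.
  - apply: (proper_on_add_leaf k3 (degk x) xS yS xy _ cP) => u uS uy.
    apply: (acyclic_neighbor_unique acG yS uS _ uy xy).
    apply: (@connect_trans _ _ r); last exact: conS.
    by rewrite (sym_connect_sym (adj_in_sym S)) conS.
have cardG : 0 < #|G| by apply/card_gt0P; exists r.
have [|S [cardS _ _ cP]] := grow #|G|.-1; first by rewrite prednK.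
rewrite prednK // in cardS; suff <- : S = setT by [].
by apply/eqP; rewrite eqEcard subsetT cardsT cardS leqnn.
Qed.

(** Under such a coloring every repetition-free path is total proper: consecutive edges share a
    vertex and have distinct other ends. *)
Lemma proper_total_proper_connected (G : sgraph) (k : nat)
    (c : total_coloring G k) :
  connected_graph G -> proper_on c setT -> total_proper_connected c.
Proof.
move=> cG [Hvv Hve Hee] x y _; have /connectP[p0 p0P ->] := cG x y.
have [p pP pU _] := shortenP p0P; exists p => //.
have step i : i < size p -> adj (nth x (x :: p) i) (nth x (x :: p) i.+1).
  by move=> ip; apply: (pathP x pP).
split=> //.
- move=> i ip; apply/eqP; rewrite [X in ecol c X != _]setUC.
  apply: Hee; rewrite ?inE //; first by rewrite adj_sym step // ltnW.
    exact: step.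
  have ip' : i < size (x :: p) by rewrite /= ltnS ltnW // ltnW.
  by rewrite nth_uniq // ltn_eqF.
- by move=> i _ ip; apply/eqP/Hvv; rewrite ?inE // step // ltnW.
- case=> // i /andP[_ ip]; split; apply/eqP; last by rewrite Hve ?inE ?step.
  by rewrite setUC Hve ?inE // adj_sym step // ltnW.
Qed.

Theorem theorem1 (T : sgraph) (treeT : is_tree T) (order_ge3 : 3 <= #|T|) :
  tpc (proj1 treeT) = max_degree T + 1.
Proof.
have [cT acT] := treeT; have D2 := connected_max_degree_ge2 cT order_ge3.
rewrite addn1 /tpc; case: ex_minnP => k /asboolP kP kmin.
apply/eqP; rewrite eqn_leq; apply/andP; split.
  apply: kmin; apply/asboolP.
  have [||c cP] := @tree_proper_coloring T (max_degree T).+1 treeT.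
  - by [].
  - by move=> x; rewrite ltnS; apply: leq_bigmax.
  - by exists c; apply: proper_total_proper_connected.
(* The lower bound is applied at a vertex of maximum degree, which exists since [T] is nonempty. *)
have [x DE] : {x : T | max_degree T = degree x}.
  by apply: eq_bigmax; apply: leq_trans order_ge3.
by rewrite DE; apply: tpc_colorable_tree_degree kP; rewrite // -DE.
Qed.
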